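(* Let $M\in\mathbb{N}_+$ and let $\{(A_i,B_i)\in\mathbb{R}^{n\times n}\times\mathbb{R}^{n\times m} : i\in\langle M\rangle\}$ be given. Consider the switched control system $x(k+1)=A_{\sigma(k)}x(k)+B_{\sigma(k)}u(k)$, $k\in\mathbb{N}$, with arbitrary switching signal $\sigma:\mathbb{N}\to\langle M\rangle$. The following equivalences hold. (Mod-Ind) The system is mode-independent feedback stabilizable (IFS) if and only if there exists $T\in\mathbb{N}$ for which there exist symmetric positive definite matrices $\bar P_{\hat w}\in\mathbb{R}^{n\times n}$ and matrices $\bar K_{\hat w}\in\mathbb{R}^{m\times n}$, for $\hat w\in\mathcal{W}(M,T)$, such that $$\begin{bmatrix}\bar P_{\hat w} & \bar P_{\hat w}A_i^\top+\bar K_{\hat w}^\top B_i^\top\\ A_i\bar P_{\hat w}+B_i\bar K_{\hat w} & \bar P_{(\hat w,i)}\end{bmatrix}\succ0\quad\text{for all }\hat w\in\mathcal{W}(M,T-1),\ i\in\langle M\rangle,$$ $$\begin{bmatrix}\bar P_{\hat w} & \bar P_{\hat w}A_i^\top+\bar K_{\hat w}^\top B_i^\top\\ A_i\bar P_{\hat w}+B_i\bar K_{\hat w} & \bar P_{\epsilon}\end{bmatrix}\succ0\quad\text{for all }\hat w\in\langle M\rangle^T,\ i\in\langle M\rangle.$$ (Mod-Dep) The system is mode-dependent feedback stabilizable (DFS) if and only if there exists $T\in\mathbb{N}$ for which there exist symmetric positive definite matrices $\bar P_{\hat w}\in\mathbb{R}^{n\times n}$, for $\hat w\in\mathcal{W}(M,T)$,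 and matrices $\bar K_{\hat w,i}\in\mathbb{R}^{m\times n}$, for $\hat w\in\mathcal{W}(M,T)$, $i\in\langle M\rangle$, such that $$\begin{bmatrix}\bar P_{\hat w} & \bar P_{\hat w}A_i^\top+\bar K_{\hat w,i}^\top B_i^\top\\ A_i\bar P_{\hat w}+B_i\bar K_{\hat w,i} & \bar P_{(\hat w,i)}\end{bmatrix}\succ0\quad\text{for all }\hat w\in\mathcal{W}(M,T-1),\ i\in\langle M\rangle,$$ $$\begin{bmatrix}\bar P_{\hat w} & \bar P_{\hat w}A_i^\top+\bar K_{\hat w,i}^\top B_i^\top\\ A_i\bar P_{\hat w}+B_i\bar K_{\hat w,i} & \bar P_{\epsilon}\end{bmatrix}\succ0\quad\text{for all }\hat w\in\langle M\rangle^T,\ i\in\langle M\rangle.$$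
   Context: $\mathbb{N}$ contains $0$; $\mathbb{N}_+=\mathbb{N}\setminus\{0\}$; $\langle M\rangle=\{1,\dots,M\}$; $|\cdot|$ is the Euclidean norm. $\langle M\rangle^k$ is the set of strings of length $k$ over $\langle M\rangle$, with $\langle M\rangle^0=\{\epsilon\}$, $\epsilon$ the empty string. $\mathcal{W}(M,T)=\bigcup_{k=0}^{T}\langle M\rangle^k$ (strings of length at most $T$), so that $\mathcal{W}(M,T-1)=\mathcal{W}(M,T)\setminus\langle M\rangle^T$ (empty when $T=0$). For a string $\hat w$ and $i\in\langle M\rangle$, $(\hat w,i)$ is the string obtained by appending $i$ at the end of $\hat w$ (so $(\epsilon,i)=i$). For symmetric matrices, $\succ 0$ means positive definite. Uniform exponential stability of a difference inclusion: for a set-valued map $F:\mathbb{R}^n\rightrightarrows\mathbb{R}^n$ with non-empty values, a solution of $x(k+1)\in F(x(k))$ from $x_0$ is a function $\phi:\mathbb{N}\to\mathbb{R}^n$ with $\phi(0)=x_0$ and $\phi(k+1)\in F(\phi(k))$ for all $k\in\mathbb{N}$. The inclusion is uniformly exponentially stable (UES) if there exist $C\ge0$ and $\gamma\in[0,1)$ such that $|\phi(k)|\le C\gamma^k|x_0|$ for all $x_0\in\mathbb{R}^n$, all solutions $\phi$ from $x_0$, and all $k\in\mathbb{N}$. The system is IFS if there exists a function $\Phi:\mathbb{R}^n\to\mathbb{R}^m$ (no regularity required) such that the inclusion $x(k+1)\in F^\Phi(x(k))$, with $F^\Phi(x)=\{A_ix+B_i\Phi(x): i\in\langle M\rangle\}$,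 is UES. The system is DFS if there exist functions $\Phi_1,\dots,\Phi_M:\mathbb{R}^n\to\mathbb{R}^m$ such that the inclusion $x(k+1)\in F_d^\Phi(x(k))$, with $F_d^\Phi(x)=\{A_ix+B_i\Phi_i(x): i\in\langle M\rangle\}$, is UES. *)

(* Defs.v *)
(* The reals are an arbitrary [R : realType]; R^n is the type ['cV[R]_n] of column
   vectors, and the set of modes {1, ..., M} is ['I_M]. *)
From mathcomp Require Import all_boot all_order all_algebra.
From mathcomp Require Import classical_sets reals.

Set Implicit Arguments.
Unset Strict Implicit.
Unset Printing Implicit Defensive.

Import Order.TTheory GRing.Theory Num.Theory.

Local Open Scope ring_scope.
Local Open Scope classical_set_scope.

(* The norm that MathComp-Analysis puts on matrices is the sup norm, hence a
   separate Euclidean norm. *)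
Definition enorm (R : realType) (n : nat) (x : 'cV[R]_n) : R :=
  Num.sqrt (\sum_(i < n) x i ord0 ^+ 2).

Definition solution (R : realType) (n : nat) (F : 'cV[R]_n -> set 'cV[R]_n)
    (x0 : 'cV[R]_n) (phi : nat -> 'cV[R]_n) : Prop :=
  phi 0%N = x0 /\ forall k : nat, F (phi k) (phi k.+1).

(* Intended for set-valued maps [F] with non-empty values; this holds for
   [ifs_map] and [dfs_map] below as soon as [0 < M]. *)
Definition UES (R : realType) (n : nat) (F : 'cV[R]_n -> set 'cV[R]_n) : Prop :=
  exists C gamma : R,
    [/\ 0 <= C, 0 <= gamma, gamma < 1 &
        forall (x0 : 'cV[R]_n) (phi : nat -> 'cV[R]_n), solution F x0 phi ->
        forall k : nat, enorm (phi k) <= C * gamma ^+ k * enorm x0].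

Definition ifs_map (R : realType) (M n m : nat)
    (A : 'I_M -> 'M[R]_n) (B : 'I_M -> 'M[R]_(n, m))
    (Phi : 'cV[R]_n -> 'cV[R]_m) (x : 'cV[R]_n) : set 'cV[R]_n :=
  [set A i *m x + B i *m Phi x | i in [set: 'I_M]].

Definition dfs_map (R : realType) (M n m : nat)
    (A : 'I_M -> 'M[R]_n) (B : 'I_M -> 'M[R]_(n, m))
    (Phi : 'I_M -> 'cV[R]_n -> 'cV[R]_m) (x : 'cV[R]_n) : set 'cV[R]_n :=
  [set A i *m x + B i *m Phi i x | i in [set: 'I_M]].

Definition IFS (R : realType) (M n m : nat)
    (A : 'I_M -> 'M[R]_n) (B : 'I_M -> 'M[R]_(n, m)) : Prop :=
  exists Phi : 'cV[R]_n -> 'cV[R]_m, UES (ifs_map A B Phi).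

Definition DFS (R : realType) (M n m : nat)
    (A : 'I_M -> 'M[R]_n) (B : 'I_M -> 'M[R]_(n, m)) : Prop :=
  exists Phi : 'I_M -> 'cV[R]_n -> 'cV[R]_m, UES (dfs_map A B Phi).

(* Positive definiteness includes symmetry; [A \is symmetricmx] is the library's
   way of saying [A = A^T]. *)
Definition posdefmx (R : realType) (n : nat) (A : 'M[R]_n) : Prop :=
  A \is symmetricmx /\
  forall x : 'cV[R]_n, x != 0 -> 0 < (x^T *m A *m x) ord0 ord0.

Lemma symmetricmxP (R : realType) (n : nat) (A : 'M[R]_n) :
  reflect (A^T = A) (A \is symmetricmx).
Proof.
apply: (iffP (is_hermitianmxP _ _ _)); rewrite expr0 scale1r map_mx_id //.
Qed.

Definition lmi_mx (R : realType) (n m : nat) (A : 'M[R]_n) (B : 'M[R]_(n, m))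
    (P : 'M[R]_n) (K : 'M[R]_(m, n)) (Q : 'M[R]_n) : 'M[R]_(n + n) :=
  block_mx P                  (P *m A^T + K^T *m B^T)
           (A *m P + B *m K)  Q.

(* Main.v *)
(* Necessity: run the stabilized system from each basis vector along a word w, and
   collect the states in X_w and the inputs in U_w, so X_(w,i) = A_i X_w + B_i U_w
   although the feedback is nonlinear. With P_w = X_w X_w^T + d_k I (k = |w|) and
   K_w = U_w X_w^T, the LMI matrix is a Gram matrix plus
   [[d_k I, d_k A_i^T], [d_k A_i, d_(k+1) I]], which is positive definite when d_k
   grows geometrically fast enough. For T large X_w X_w^T <= I/2 on words of length
   T + 1, while P_epsilon >= I, so the last LMIs hold once d_T is small.
   Sufficiency: V(x) = min_w x^T P_w^-1 x is a Lyapunov function under the feedback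
   x |-> K_w P_w^-1 x, where w attains the minimum at x.
   Mode-independent feedback is the case of a feedback constant in the mode. *)
Require Import Defs.
From mathcomp Require Import all_boot all_order all_algebra.
From mathcomp Require Import classical_sets reals normedtype sequences.
From mathcomp Require Import ring lra.

Set Implicit Arguments.
Unset Strict Implicit.
Unset Printing Implicit Defensive.

Import Order.TTheory GRing.Theory Num.Theory.
Import numFieldNormedType.Exports.

Local Open Scope ring_scope.


(** * Inner product, quadratic forms and positive definite matrices *)

Section Dot.
Variable R : realType.

Definition dot (n : nat) (x y : 'cV[R]_n) : R := (x^T *m y) ord0 ord0.

Lemma dotE n (x y : 'cV[R]_n) : dot x y = \sum_i x i ord0 * y i ord0.
Proof. by rewrite /dot mxE; apply: eq_bigr => i _; rewrite mxE. Qed.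

Lemma dotC n (x y : 'cV[R]_n) : dot x y = dot y x.
Proof. by rewrite !dotE; apply: eq_bigr => i _; rewrite mulrC. Qed.

Lemma dotDr n (x y z : 'cV[R]_n) : dot x (y + z) = dot x y + dot x z.
Proof. by rewrite /dot mulmxDr mxE. Qed.

Lemma dotDl n (x y z : 'cV[R]_n) : dot (x + y) z = dot x z + dot y z.
Proof. by rewrite dotC dotDr !(dotC z). Qed.

Lemma dotZr n a (x y : 'cV[R]_n) : dot x (a *: y) = a * dot x y.
Proof. by rewrite /dot -scalemxAr mxE. Qed.

Lemma dotZl n a (x y : 'cV[R]_n) : dot (a *: x) y = a * dot x y.
Proof. by rewrite dotC dotZr dotC. Qed.

Lemma dotNr n (x y : 'cV[R]_n) : dot x (- y) = - dot x y.
Proof. by rewrite -scaleN1r dotZr mulN1r. Qed.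

Lemma dotNl n (x y : 'cV[R]_n) : dot (- x) y = - dot x y.
Proof. by rewrite dotC dotNr dotC. Qed.

Lemma dot0r n (x : 'cV[R]_n) : dot x 0 = 0.
Proof. by rewrite /dot mulmx0 mxE. Qed.

Lemma dot0l n (x : 'cV[R]_n) : dot 0 x = 0.
Proof. by rewrite dotC dot0r. Qed.

Lemma dot_mulmx n p (G : 'M[R]_(n, p)) (x : 'cV[R]_n) (y : 'cV[R]_p) :
  dot x (G *m y) = dot (G^T *m x) y.
Proof. by rewrite /dot trmx_mul trmxK mulmxA. Qed.

Lemma dot_col_mx n p (x x' : 'cV[R]_n) (y y' : 'cV[R]_p) :
  dot (col_mx x y) (col_mx x' y') = dot x x' + dot y y'.
Proof. by rewrite /dot tr_col_mx mul_row_col mxE. Qed.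

Lemma dot_ge0 n (x : 'cV[R]_n) : 0 <= dot x x.
Proof. by rewrite dotE sumr_ge0 // => i _; rewrite -expr2 sqr_ge0. Qed.

Lemma dot_eq0 n (x : 'cV[R]_n) : (dot x x == 0) = (x == 0).
Proof.
apply/eqP/eqP => [|->]; last exact: dot0r.
rewrite dotE => /psumr_eq0P H; apply/colP => i.
have /eqP := H (fun i _ => sqr_ge0 (x i ord0)) i isT.
by rewrite mulf_eq0 orbb mxE => /eqP.
Qed.

Lemma dot_gt0 n (x : 'cV[R]_n) : (0 < dot x x) = (x != 0).
Proof. by rewrite lt0r dot_eq0 dot_ge0 andbT. Qed.

Lemma enormE n (x : 'cV[R]_n) : enorm x = Num.sqrt (dot x x).
Proof. by rewrite /enorm dotE; under eq_bigr do rewrite expr2. Qed.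

Lemma sqr_enorm n (x : 'cV[R]_n) : enorm x ^+ 2 = dot x x.
Proof. by rewrite enormE sqr_sqrtr // dot_ge0. Qed.

Lemma posdefmxP n (S : 'M[R]_n) :
  posdefmx S <-> S^T = S /\ forall x, x != 0 -> 0 < dot x (S *m x).
Proof.
rewrite /posdefmx /dot; split=> -[/symmetricmxP sS hS]; split=> // x /hS.
  by rewrite mulmxA.
by rewrite mulmxA.
Qed.

Lemma posdefmx_dot_ge0 n (S : 'M[R]_n) x : posdefmx S -> 0 <= dot x (S *m x).
Proof.
move=> /posdefmxP[_ hS]; have [->|/hS/ltW//] := eqVneq x 0.
by rewrite mulmx0 dot_ge0.
Qed.

Lemma posdefmx1 n : posdefmx (1%:M : 'M[R]_n).
Proof.
by apply/posdefmxP; split=> [|x]; rewrite ?trmx1// mul1mx dot_gt0.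
Qed.

Lemma posdefmx_CauchySchwarz n (S : 'M[R]_n) x y : posdefmx S ->
  dot x (S *m y) ^+ 2 <= dot x (S *m x) * dot y (S *m y).
Proof.
move=> pS; have /posdefmxP[sS hS] := pS.
have [->|/hS y0] := eqVneq y 0.
  by rewrite !mulmx0 !dot0r mulr0 expr2 mul0r.
set b := dot x _; set a := dot x _; set d := dot y _ in y0 *.
have Sxy : dot y (S *m x) = b by rewrite dot_mulmx sS dotC.
(* The form at [d *: x - b *: y] equals [d * (a * d - b ^+ 2)], and [d] is positive. *)
have := posdefmx_dot_ge0 (d *: x - b *: y) pS.
rewrite mulmxBr -!scalemxAr !(dotDl, dotDr, dotNl, dotNr, dotZl, dotZr).
rewrite Sxy -/a -/b -/d.
rewrite [X in 0 <= X](_ : _ = d * (a * d - b ^+ 2)).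
  by rewrite pmulr_rge0// subr_ge0.
ring.
Qed.

Lemma dot_CauchySchwarz n (x y : 'cV[R]_n) : dot x y ^+ 2 <= dot x x * dot y y.
Proof. by have := posdefmx_CauchySchwarz x y (posdefmx1 n); rewrite !mul1mx. Qed.

(** Cauchy-Schwarz in each coordinate; the constant is the squared Frobenius norm of [X]. *)
Lemma dot_trmx_mulmx_le n p (X : 'M[R]_(n, p)) y :
  dot (X^T *m y) (X^T *m y) <= (\sum_j dot (col j X) (col j X)) * dot y y.
Proof.
rewrite dotE mulr_suml; apply: ler_sum => j _.
suff -> : (X^T *m y) j ord0 = dot (col j X) y by rewrite -expr2 dot_CauchySchwarz.
by rewrite dotE mxE; apply: eq_bigr => i _; rewrite !mxE.
Qed.

(** From 2<y, Gy> <= |y|^2 + |Gy|^2 and the Frobenius bound on |Gy|^2. *)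
Lemma qform_le n (G : 'M[R]_n) : exists c, forall y, dot y (G *m y) <= c * dot y y.
Proof.
exists ((1 + \sum_j dot (col j G^T) (col j G^T)) / 2) => y.
have := dot_trmx_mulmx_le G^T y; rewrite trmxK.
have := dot_ge0 (y - G *m y).
rewrite !(dotDl, dotDr, dotNl, dotNr) (dotC (G *m y) y).
by move: (\sum_j _) => s; lra.
Qed.

Lemma posdefmx_unit n (S : 'M[R]_n) : posdefmx S -> S \in unitmx.
Proof.
move=> /posdefmxP[sS hS]; rewrite -row_free_unit; apply: inj_row_free => v vS.
apply/eqP; rewrite -(inj_eq trmx_inj) trmx0; apply: contraTT isT => /hS.
by rewrite -sS -trmx_mul vS trmx0 dot0r ltxx.
Qed.

Lemma posdefmx_inv n (S : 'M[R]_n) : posdefmx S -> posdefmx (invmx S).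
Proof.
move=> pS; have uS := posdefmx_unit pS; have /posdefmxP[sS hS] := pS.
have sI : (invmx S)^T = invmx S by rewrite trmx_inv sS.
apply/posdefmxP; split=> // x x0.
have Sx : S *m (invmx S *m x) = x by rewrite mulmxA mulmxV// mul1mx.
rewrite -{1}Sx dotC; apply: hS; apply: contraNneq x0 => Ix0.
by rewrite -Sx Ix0 mulmx0.
Qed.

(* Cauchy-Schwarz for the form of S bounds each coordinate x_i = <x, S (S^-1 e_i)>,
   which gives the constant tr(S^-1). *)
Lemma posdefmx_dot_le n (S : 'M[R]_n) : posdefmx S ->
  exists c, forall x, dot x x <= c * dot x (S *m x).
Proof.
move=> pS; have uS := posdefmx_unit pS.
exists (\tr (invmx S)) => x; rewrite dotE /mxtrace mulr_suml.
apply: ler_sum => i _; rewrite mulrC.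
have S2 (y : 'cV[R]_n) : S *m (invmx S *m y) = y by rewrite mulmxA mulmxV// mul1mx.
have := posdefmx_CauchySchwarz x (invmx S *m delta_mx i ord0) pS; rewrite S2.
have dotd (y : 'cV[R]_n) : dot y (delta_mx i ord0) = y i ord0.
  by rewrite /dot -colE !mxE.
by rewrite !dotd -colE mxE -expr2 mulrC.
Qed.

(** Merges the constants obtained word by word and mode by mode: one plus the sum of their absolute
    values dominates each. *)
Lemma fin_uniform_bound (I : finType) (Q : I -> R -> Prop) :
  (forall i c c', c <= c' -> Q i c -> Q i c') ->
  (forall i, exists c, Q i c) -> exists2 c, 1 <= c & forall i, Q i c.
Proof.
move=> mQ /fin_all_exists[u Qu]; exists (1 + \sum_i `|u i|).
  by rewrite lerDl sumr_ge0.
move=> i; apply: mQ (Qu i); rewrite (bigD1 i)//=.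
rewrite addrCA (le_trans (ler_norm _))// lerDl addr_ge0// sumr_ge0//.
Qed.

End Dot.

(** * The LMI block matrix *)

Section LMI.
Variables (R : realType) (n m : nat).
Implicit Types (A P Q X : 'M[R]_n) (B : 'M[R]_(n, m)) (K U : 'M[R]_(m, n)).

Lemma lmi_mx_dot A B P K Q (x y : 'cV[R]_n) : P^T = P ->
  dot (col_mx x y) (lmi_mx A B P K Q *m col_mx x y) =
  dot x (P *m x) + 2 * dot y ((A *m P + B *m K) *m x) + dot y (Q *m y).
Proof.
move=> sP; rewrite /lmi_mx mul_block_col dot_col_mx !dotDr.
have -> : P *m A^T + K^T *m B^T = (A *m P + B *m K)^T.
  by rewrite linearD /= !trmx_mul sP.
by rewrite (dot_mulmx _^T) trmxK (dotC _ y); ring.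
Qed.

Lemma lmi_mx_sym A B P K Q : P^T = P -> Q^T = Q ->
  (lmi_mx A B P K Q)^T = lmi_mx A B P K Q.
Proof.
move=> sP sQ; rewrite /lmi_mx tr_block_mx sP sQ; congr block_mx.
  by rewrite linearD /= !trmx_mul sP.
by rewrite linearD /= !trmx_mul !trmxK sP.
Qed.

Lemma posdefmx_gram X d : 0 < d -> posdefmx (X *m X^T + d%:M).
Proof.
move=> d0; apply/posdefmxP; split.
  by rewrite linearD /= trmx_mul trmxK tr_scalar_mx.
move=> x x0; rewrite mulmxDl dotDr -mulmxA dot_mulmx mul_scalar_mx dotZr.
by rewrite ltr_wpDl ?dot_ge0// mulr_gt0// dot_gt0.
Qed.

(* With X' = A X + B U, the LMI matrix is the Gram matrix of (X; X') plus
   [[d, d A^T], [d A, Q - X' X'^T]]. *)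
Lemma posdefmx_lmi_gram A B X U Q d : 0 < d -> Q^T = Q ->
  (forall y, y != 0 ->
    dot ((A *m X + B *m U)^T *m y) ((A *m X + B *m U)^T *m y)
    + d * dot (A^T *m y) (A^T *m y) < dot y (Q *m y)) ->
  posdefmx (lmi_mx A B (X *m X^T + d%:M) (U *m X^T) Q).
Proof.
move=> d0 sQ hQ.
have /posdefmxP[sP _] := posdefmx_gram X d0.
apply/posdefmxP; split; first exact: lmi_mx_sym.
move=> v; rewrite -[v]vsubmxK; move: (usubmx v) (dsubmx v) => x y {v} v0.
rewrite lmi_mx_dot//.
have -> : A *m (X *m X^T + d%:M) + B *m (U *m X^T)
    = (A *m X + B *m U) *m X^T + d *: A.
  by rewrite mulmxDr mulmxDl -!mulmxA mul_mx_scalar addrAC.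
move: (A *m X + B *m U) hQ => X' hQ.
rewrite !mulmxDl !dotDr -!mulmxA mul_scalar_mx -scalemxAl !dotZr.
rewrite (dot_mulmx X x) (dot_mulmx X' y) (dot_mulmx A y).
have h1 := dot_ge0 (X^T *m x + X'^T *m y).
rewrite !(dotDl, dotDr) (dotC (X^T *m x) (X'^T *m y)) in h1.
have h2 := dot_ge0 (x + A^T *m y).
rewrite -(pmulr_rge0 _ d0) !(dotDl, dotDr) (dotC x (A^T *m y)) in h2.
have [y0|/hQ h3] := eqVneq y 0; last first.
  by lra.
have x0 : x != 0 by apply: contraNneq v0 => ->; rewrite y0 col_mx0.
have := mulr_gt0 d0 (etrans (dot_gt0 x) x0).
have := dot_ge0 (X^T *m x).
rewrite y0 !mulmx0 !dot0l; lra.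
Qed.

(* Schur complement: the LMI form is evaluated at (P^-1 x, - Q^-1 z). *)
Lemma lmi_mx_decrease A B P K Q : posdefmx P -> posdefmx Q ->
  posdefmx (lmi_mx A B P K Q) ->
  exists c, forall x, let z := A *m x + B *m (K *m (invmx P *m x)) in
    dot z (invmx Q *m z) <= dot x (invmx P *m x) /\
    dot x (invmx P *m x)
      <= c * (dot x (invmx P *m x) - dot z (invmx Q *m z)).
Proof.
move=> pP pQ pL; have [c Lc] := posdefmx_dot_le pL; have [p Pp] := qform_le P.
have /posdefmxP[sP _] := pP.
have [uP uQ] := (posdefmx_unit pP, posdefmx_unit pQ).
have /posdefmxP[sIQ _] := posdefmx_inv pQ.
(* With y = P^-1 x, the form x^T P^-1 x = y^T P y is at most p |y|^2, and |y|^2 is at most [c] times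
   the LMI form, which is the decrease. *)
exists (`|p| * c) => x z.
set y := invmx P *m x; have Py : P *m y = x by rewrite mulmxA mulmxV// mul1mx.
have Yy : (A *m P + B *m K) *m y = z by rewrite mulmxDl -!mulmxA Py.
set v := - (invmx Q *m z).
have LE : dot (col_mx y v) (lmi_mx A B P K Q *m col_mx y v)
    = dot x (invmx P *m x) - dot z (invmx Q *m z).
  rewrite lmi_mx_dot// Py Yy /v mulmxN (mulmxA Q) mulmxV// mul1mx.
  by rewrite !dotNl dotNr (dotC y x) (dotC _ z) -/y; ring.
have := Lc (col_mx y v); rewrite LE dot_col_mx => h1.
have h0 := posdefmx_dot_ge0 (col_mx y v) pL; rewrite LE in h0.
split; first by rewrite -subr_ge0.
have := Pp y; rewrite Py dotC -/y => h2.
apply: (le_trans h2); rewrite -mulrA.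
apply: (le_trans (ler_wpM2r (dot_ge0 y) (ler_norm p))).
by apply: ler_wpM2l => //; apply: le_trans h1; rewrite lerDl dot_ge0.
Qed.

End LMI.

(** * Sufficiency: from the LMIs to a Lyapunov function *)

Lemma lyapunov_UES (R : realType) (n : nat) (F : 'cV[R]_n -> set 'cV[R]_n)
    (V : 'cV[R]_n -> R) (c : R) :
  1 <= c ->
  (forall x, dot x x <= c * V x) -> (forall x, V x <= c * dot x x) ->
  (forall x z, F x z -> V x <= c * (V x - V z)) -> UES F.
Proof.
move=> c1 lV uV dV; have c0 : 0 < c by lra.
have r0 : 0 <= 1 - c^-1 by rewrite subr_ge0 invf_le1.
(* [V] contracts by 1 - 1/c at each step and is comparable to the squared norm, hence the square
   root; the two comparisons together cost c^2 on squares. *)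
exists c, (Num.sqrt (1 - c^-1)); split.
- exact: ltW.
- exact: sqrtr_ge0.
- by rewrite -[ltRHS]sqrtr1 ltr_sqrt// gtrBl invr_gt0.
move=> x0 phi [phi0 phiS] k.
have Vk : V (phi k) <= (1 - c^-1) ^+ k * V x0.
  elim: k => [|k IH]; first by rewrite phi0 expr0 mul1r.
  have := dV _ _ (phiS k); rewrite mulrC -ler_pdivrMr// => h.
  have h' : V (phi k.+1) <= (1 - c^-1) * V (phi k) by rewrite mulrBl mul1r mulrC; lra.
  by rewrite (le_trans h')// exprS -mulrA ler_wpM2l.
rewrite -ler_sqr ?nnegrE ?mulr_ge0 ?exprn_ge0 ?sqrtr_ge0//; last exact: ltW.
rewrite !exprMn !sqr_enorm -exprM mulnC exprM sqr_sqrtr//.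
apply: (le_trans (lV _)); rewrite expr2 -!mulrA ler_pM2l//.
apply: (le_trans Vk); rewrite mulrCA; apply: ler_wpM2l; first exact: exprn_ge0.
exact: uV.
Qed.

(* The Lyapunov function is the minimum of the quadratic forms x^T P_w^-1 x, and
   [sel x] is a word that attains it at [x]. *)
Lemma lmi_dfs_UES (R : realType) (M n m : nat)
    (A : 'I_M -> 'M[R]_n) (B : 'I_M -> 'M[R]_(n, m)) (T : nat)
    (P : seq 'I_M -> 'M[R]_n) (K : seq 'I_M -> 'I_M -> 'M[R]_(m, n)) :
  (forall w, (size w <= T)%N -> posdefmx (P w)) ->
  (forall w i, (size w < T)%N ->
     posdefmx (lmi_mx (A i) (B i) (P w) (K w i) (P (rcons w i)))) ->
  (forall w i, size w = T ->
     posdefmx (lmi_mx (A i) (B i) (P w) (K w i) (P [::]))) ->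
  exists sel : 'cV[R]_n -> seq 'I_M,
    UES (dfs_map A B (fun i x => K (sel x) i *m (invmx (P (sel x)) *m x))).
Proof.
move=> hP hlt hT.
(* Words of length at most [T] form a finite type, so minima and uniform constants exist. *)
pose q (w : T.-bseq 'I_M) (x : 'cV[R]_n) := dot x (invmx (P w) *m x).
pose sel x := [arg min_(w < [bseq] : T.-bseq 'I_M) q w x]%O.
have selP x w : q (sel x) x <= q w x.
  by rewrite /sel; case: arg_minP => // w0 _; apply.
have pP (w : T.-bseq 'I_M) : posdefmx (P w) by apply: hP; exact: size_bseq.
(* Both LMI families at once: the successor is (w,i), or the empty word when w has length [T]. *)
have step (wi : T.-bseq 'I_M * 'I_M) : exists w' : T.-bseq 'I_M,
    posdefmx (lmi_mx (A wi.2) (B wi.2) (P wi.1) (K wi.1 wi.2) (P w')).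
  case: wi => w i /=; have := size_bseq w; rewrite leq_eqVlt.
  case/orP => [/eqP/hT|sw]; first by move/(_ i) => H; exists [bseq].
  have sr : (size (rcons w i) <= T)%N by rewrite size_rcons.
  by exists (Bseq sr); apply: hlt.
have [nxt nxtP] := fin_all_exists step.
have [c1 c11 lq] : exists2 c, 1 <= c & forall w x, dot x x <= c * q w x.
  apply: fin_uniform_bound => [w c c' cc' H x|w].
    apply: (le_trans (H x)); apply: ler_wpM2r => //.
    exact: posdefmx_dot_ge0 (posdefmx_inv _).
  exact: posdefmx_dot_le (posdefmx_inv _).
have [c2 c21 uq] : exists2 c, 1 <= c & forall w x, q w x <= c * dot x x.
  apply: fin_uniform_bound => [w c c' cc' H x|w]; last exact: qform_le.
  by apply: (le_trans (H x)); apply: (ler_wpM2r (dot_ge0 _)).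
pose z (wi : T.-bseq 'I_M * 'I_M) (x : 'cV[R]_n) :=
  A wi.2 *m x + B wi.2 *m (K wi.1 wi.2 *m (invmx (P wi.1) *m x)).
(* The first conjunct makes the second monotone in [c], as [fin_uniform_bound] requires. *)
have [c3 c31 dq] : exists2 c, 1 <= c & forall wi x,
    q (nxt wi) (z wi x) <= q wi.1 x /\
    q wi.1 x <= c * (q wi.1 x - q (nxt wi) (z wi x)).
  apply: fin_uniform_bound => [wi c c' cc' H x|wi].
    have [H1 H2] := H x; split=> //; apply: (le_trans H2).
    by apply: ler_wpM2r; rewrite ?subr_ge0.
  exact: lmi_mx_decrease (nxtP wi).
exists (fun x => bseqval (sel x)).
pose c := c1 + c2 + c3.
apply: (@lyapunov_UES _ _ _ (fun x => q (sel x) x) c).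
- by rewrite /c; lra.
- move=> x; apply: (le_trans (lq (sel x) x)); apply: ler_wpM2r; last by rewrite /c; lra.
  exact: posdefmx_dot_ge0 (posdefmx_inv _).
- move=> x; apply: (le_trans (uq (sel x) x)); apply: (ler_wpM2r (dot_ge0 _)).
  by rewrite /c; lra.
move=> x _ [i _ <-].
have [d1 d2] := dq (sel x, i) x; rewrite -/(z (sel x, i) x).
(* The minimum at the new state is at most the form of the successor word, so it decreases at least
   as much. *)
have s := selP (z (sel x, i) x) (nxt (sel x, i)).
apply: (le_trans d2); apply: ler_pM; rewrite ?subr_ge0//; [lra|rewrite /c; lra|].
by rewrite lerD2l lerN2.
Qed.

(** * Necessity: the tree of states reached along words *)

Lemma expr_small (R : realType) (g e : R) : 0 <= g -> g < 1 -> 0 < e ->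
  exists k, g ^+ k.+1 < e.
Proof.
move=> g0 g1 e0; have : `|g| < 1 by rewrite ger0_norm.
move=> /cvg_expr h; move/cvgr0_norm_lt: h => /(_ e e0)[k _ /(_ k.+1 (leqnSn k))].
by rewrite ger0_norm ?exprn_ge0// => gk; exists k.
Qed.

Section Tree.
Variables (R : realType) (M n m : nat).
Variables (A : 'I_M -> 'M[R]_n) (B : 'I_M -> 'M[R]_(n, m)).
Variable Phi : 'I_M -> 'cV[R]_n -> 'cV[R]_m.

Definition feedback_mx (i : 'I_M) (X : 'M[R]_n) : 'M[R]_(m, n) :=
  \matrix_(a, j) Phi i (col j X) a ord0.

(* Column j of [state_mx w] is the state reached from the j-th basis vector along
   the modes of [w], read from left to right. *)
Definition state_mx (w : seq 'I_M) : 'M[R]_n :=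
  foldl (fun X i => A i *m X + B i *m feedback_mx i X) 1%:M w.

Lemma state_mx_rcons w i :
  state_mx (rcons w i) = A i *m state_mx w + B i *m feedback_mx i (state_mx w).
Proof. by rewrite /state_mx foldl_rcons. Qed.

Lemma col_state_mx_rcons w i j :
  col j (state_mx (rcons w i)) =
  A i *m col j (state_mx w) + B i *m Phi i (col j (state_mx w)).
Proof.
rewrite state_mx_rcons colE mulmxDl -!mulmxA -!colE; congr (_ + _ *m _).
by apply/colP => a; rewrite !mxE.
Qed.

(** UES speaks of infinite solutions only, so [w] is continued forever with the default mode
    [i0]. *)
Lemma state_mx_solution (i0 : 'I_M) (w : seq 'I_M) (j : 'I_n) :
  solution (dfs_map A B Phi) (col j 1%:M)
    (fun k => col j (state_mx (mkseq (nth i0 w) k))).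
Proof.
split=> // k; rewrite mkseqS; exists (nth i0 w k) => //.
by rewrite col_state_mx_rcons.
Qed.

Lemma state_mx_small (i0 : 'I_M) : UES (dfs_map A B Phi) ->
  exists T, forall w, size w = T.+1 -> forall y,
    dot ((state_mx w)^T *m y) ((state_mx w)^T *m y) <= 2^-1 * dot y y.
Proof.
case=> C [g [C0 g0 g1 hC]].
(* The n columns contribute at most n C^2 g^(T+1), to be brought below 1/2; the added 1 keeps the
   divisor positive. *)
have b0 : 0 < 2 * (n%:R * C ^+ 2 + 1) :> R.
  by rewrite mulr_gt0// ltr_wpDl// mulr_ge0 ?sqr_ge0.
have [T gT] : exists T, g ^+ T.+1 < (2 * (n%:R * C ^+ 2 + 1))^-1.
  by apply: expr_small; rewrite ?invr_gt0.
exists T => w sw y.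
apply: (le_trans (dot_trmx_mulmx_le _ _)); apply: (ler_wpM2r (dot_ge0 _)).
have cj j : dot (col j (state_mx w)) (col j (state_mx w)) <= C ^+ 2 * g ^+ T.+1.
  have := hC _ _ (state_mx_solution i0 w j) T.+1.
  rewrite -{1}sw mkseq_nth => h.
  have e1 : enorm (col j 1%:M : 'cV[R]_n) = 1.
    rewrite enormE dotE (bigD1 j)//= big1 => [|i ij].
      by rewrite !mxE eqxx mulr1 addr0 sqrtr1.
    by rewrite !mxE (negPf ij) mul0r.
  rewrite e1 mulr1 in h.
  rewrite -sqr_enorm (@le_trans _ _ ((C * g ^+ T.+1) ^+ 2))//.
    by rewrite ler_sqr// nnegrE ?enormE ?sqrtr_ge0// mulr_ge0// exprn_ge0.
  rewrite exprMn; apply: ler_wpM2l; first exact: sqr_ge0.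
  by rewrite expr2 ler_piMl ?exprn_ge0// exprn_ile1// ltW.
apply: (le_trans (ler_sum _ (fun j _ => cj j))).
rewrite sumr_const card_ord -[leLHS]mulr_natl mulrA.
move: gT; rewrite -[ltRHS]mul1r ltr_pdivlMr// => gT.
have := exprn_ge0 T.+1 g0; lra.
Qed.

(** The gains are given explicitly so that a feedback constant in the mode visibly yields gains
    constant in the mode. *)
Lemma dfs_UES_lmi (hM : (0 < M)%N) : UES (dfs_map A B Phi) ->
  exists T (P X : seq 'I_M -> 'M[R]_n),
    let K w i := feedback_mx i (X w) *m (X w)^T in
    [/\ forall w, (size w <= T)%N -> posdefmx (P w),
        forall w i, (size w < T)%N ->
          posdefmx (lmi_mx (A i) (B i) (P w) (K w i) (P (rcons w i)))
      & forall w i, size w = T ->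
          posdefmx (lmi_mx (A i) (B i) (P w) (K w i) (P [::]))].
Proof.
move=> /(state_mx_small (Ordinal hM))[T XT].
pose a : R := \sum_i \sum_j dot (col j (A i)) (col j (A i)).
have a0 : 0 <= a by do 2![apply: sumr_ge0 => ? _]; exact: dot_ge0.
have Aa i y : dot ((A i)^T *m y) ((A i)^T *m y) <= a * dot y y.
  apply: (le_trans (dot_trmx_mulmx_le _ _)); apply: (ler_wpM2r (dot_ge0 _)).
  rewrite /a [leRHS](bigD1 i)//= lerDl.
  by do 2![apply: sumr_ge0 => ? _]; exact: dot_ge0.
have a1 : 0 < a + 1 by lra.
(* The ratio a + 1 strictly beats the bound a on |A_i^T y|^2 / |y|^2; the scaling makes d_(T+1) =
   1/2. *)
pose d (k : nat) : R := (2 * (a + 1) ^+ T.+1)^-1 * (a + 1) ^+ k.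
have d0 k : 0 < d k.
  by rewrite /d pmulr_rgt0 ?exprn_gt0 // invr_gt0 pmulr_rgt0 // exprn_gt0.
have dS k : d k.+1 = d k * (a + 1) by rewrite /d (exprSr _ k) mulrA.
have dT : d T.+1 = 2^-1 by rewrite /d invfM mulfVK// expf_neq0// gt_eqF.
pose P w := state_mx w *m (state_mx w)^T + (d (size w))%:M.
have pP w : posdefmx (P w) by apply: posdefmx_gram.
have sP w : (P w)^T = P w by case/posdefmxP: (pP w).
have PE w y : dot y (P w *m y)
    = dot ((state_mx w)^T *m y) ((state_mx w)^T *m y) + d (size w) * dot y y.
  by rewrite mulmxDl dotDr -mulmxA dot_mulmx mul_scalar_mx dotZr.
have dA k i (y : 'cV[R]_n) : y != 0 ->
    d k * dot ((A i)^T *m y) ((A i)^T *m y) < d k.+1 * dot y y.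
  rewrite -dot_gt0 => y0; rewrite dS -mulrA ltr_pM2l//.
  by apply: (le_lt_trans (Aa i y)); rewrite mulrDl mul1r ltrDl.
exists T, P, state_mx; split=> [w _|w i sw|w i sw]; first exact: pP.
  apply: posdefmx_lmi_gram => // y y0; rewrite -state_mx_rcons PE size_rcons.
  by rewrite ltrD2l dA.
apply: posdefmx_lmi_gram => // y y0; rewrite -state_mx_rcons PE.
(* The states and the d_T term each cost at most |y|^2 / 2, while P_epsilon = (1 + d_0) I. *)
have := XT (rcons w i); rewrite size_rcons sw => /(_ erefl y) h.
have := dA T i y y0; rewrite dT /state_mx /= trmx1 mul1mx => h'.
have yy : 0 < dot y y by rewrite dot_gt0.
have := mulr_gt0 (d0 0) yy; lra.
Qed.

End Tree.

(* Strings over the modes are sequences [w : seq 'I_M], the empty string is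
   [[::]] and (w, i) is [rcons w i]. A family indexed by the strings of length at
   most T is a function on all strings, of which only the values at strings of
   length at most T occur in the conditions. *)
Theorem theorem2 (R : realType) (M n m : nat) (hM : (0 < M)%N)
    (A : 'I_M -> 'M[R]_n) (B : 'I_M -> 'M[R]_(n, m)) :
  (IFS A B <->
   exists T : nat,
   exists (P : seq 'I_M -> 'M[R]_n) (K : seq 'I_M -> 'M[R]_(m, n)),
     [/\ forall w : seq 'I_M, (size w <= T)%N -> posdefmx (P w),
         forall (w : seq 'I_M) (i : 'I_M), (size w < T)%N ->
           posdefmx (lmi_mx (A i) (B i) (P w) (K w) (P (rcons w i)))
       & forall (w : seq 'I_M) (i : 'I_M), size w = T ->
           posdefmx (lmi_mx (A i) (B i) (P w) (K w) (P [::]))])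
  /\
  (DFS A B <->
   exists T : nat,
   exists (P : seq 'I_M -> 'M[R]_n) (K : seq 'I_M -> 'I_M -> 'M[R]_(m, n)),
     [/\ forall w : seq 'I_M, (size w <= T)%N -> posdefmx (P w),
         forall (w : seq 'I_M) (i : 'I_M), (size w < T)%N ->
           posdefmx (lmi_mx (A i) (B i) (P w) (K w i) (P (rcons w i)))
       & forall (w : seq 'I_M) (i : 'I_M), size w = T ->
           posdefmx (lmi_mx (A i) (B i) (P w) (K w i) (P [::]))]).
Proof.
split; split.
- move=> [Phi /(dfs_UES_lmi hM)[T [P [X H]]]].
  (* The mode [Ordinal hM] is arbitrary: the feedback ignores it. *)
  exists T, P, (fun w =>
    feedback_mx (fun _ : 'I_M => Phi) (Ordinal hM) (X w) *m (X w)^T).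
  exact: H.
- move=> [T [P [K [hP hlt hT]]]].
  (* [sel] depends on the state alone, so gains constant in the mode give a mode-independent
     feedback. *)
  have [sel H] := lmi_dfs_UES (K := fun w _ => K w) hP hlt hT.
  by exists (fun x => K (sel x) *m (invmx (P (sel x)) *m x)).
- move=> [Phi /(dfs_UES_lmi hM)[T [P [X H]]]].
  by exists T, P, (fun w i => feedback_mx Phi i (X w) *m (X w)^T).
- move=> [T [P [K [hP hlt hT]]]].
  have [sel H] := lmi_dfs_UES hP hlt hT.
  by exists (fun i x => K (sel x) i *m (invmx (P (sel x)) *m x)).
Qed.
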